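(* Let $\varphi:\mathbb{R}^+\to\mathbb{R}^+$ be a continuous function. Consider the following three forms: (i) $\varphi$ is injective; (ii) there is $y_0>0$ such that $\varphi=\mathbf{0}$ on $[0,y_0]$ and $\varphi$ is strictly increasing on $]y_0,+\infty[$; (iii) there is $x_0\geq 0$ such that $\varphi=\mathbf{0}$ on $[x_0,+\infty[$ and $\varphi$ is strictly decreasing on $[0,x_0[$ (for $x_0=0$ this is the case $\varphi=\mathbf{0}$). If $\varphi$ is not of the form (i), (ii) or (iii), then there is no function $f$ such that $h_f=\varphi$ on $\mathbb{R}_0^+$. If $\varphi$ is of the form (i), (ii) or (iii), then the solution $f$ of $h_f=\varphi$ on $\mathbb{R}_0^+$ (equivalently, of $f(\varphi(\theta))=\theta\cdot\varphi(\theta)$ for all $\theta\in\mathbb{R}^+$) is given by $$\forall x\in\mathbb{R}_0^+:\quad f(x)=x\,\varphi^{-1}(x),$$ where $\varphi^{-1}$ is the inverse function of the injective part of $\varphi$ (that is, of $\varphi$ in case (i), of $\varphi|_{]y_0,+\infty[}$ in case (ii), of $\varphi|_{[0,x_0[}$ in case (iii)). This function $\varphi^{-1}$ always exists, except when $x_0=0$ in (iii), in which case $\varphi=\mathbf{0}$ and $\varphi=h_f$ with $f=\mathbf{0}$. Moreover, in cases (ii) and (iii), $f(0)=0$.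
   Context: $\mathbb{R}^+=[0,+\infty[$ and $\mathbb{R}_0^+=\mathbb{R}^+\setminus\{0\}$; $\mathbf{0}$ denotes the null function (identically zero). For a function $f:\mathbb{R}^+\to\mathbb{R}^+$, the Hirsch function $h_f:\mathbb{R}_0^+\to\mathbb{R}^+$ is defined, for $\theta\in\mathbb{R}_0^+$, by: $x=h_f(\theta)\Leftrightarrow f(x)=\theta x$. Only functions $f$ are considered for which this equation has a unique solution $x$ for every $\theta\in\mathbb{R}_0^+$, with the following convention: if $f(0)=0$ (so that $x=0$ always solves the equation), the solution $x=0$ is disregarded whenever a solution $x>0$ exists, and $h_f(\theta)=0$ if $x=0$ is the only solution.
   Formalization: The inverse of φ is extended by 0 outside its range; the equivalence with f(φ(θ))=θφ(θ) adds that f vanishes at positive points outside φ(R^+), and in case (i) with φ(0)=0 assumes f(0)=0, since it fails otherwise. *)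

(* Defs.v *)
From mathcomp Require Import all_boot all_order all_algebra.
From mathcomp Require Import all_classical all_reals all_analysis.
Import numFieldNormedType.Exports.
Set Implicit Arguments.
Unset Strict Implicit.
Unset Printing Implicit Defensive.
Import Order.TTheory GRing.Theory Num.Theory.
Local Open Scope classical_set_scope.
Local Open Scope ring_scope.

Section Hirsch.
Variable R : realType.
Implicit Types (f g phi : R -> R) (D : set R) (x y theta : R).

(* A function from [0, +oo[ to itself is encoded as a total function on R that
   preserves nonnegativity; its values on negative numbers are never used. *)
Definition nonneg_map f : Prop := forall x, 0 <= x -> 0 <= f x.

(* The solutions x of f(x) = theta x in [0, +oo[, from which x = 0 is discarded
   as soon as there is a positive one.  (x = 0 is a solution iff f(0) = 0.) *)
Definition hirsch_solutions f theta : set R :=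
  [set x | [/\ 0 <= x, f x = theta * x &
               x = 0 -> ~ exists2 z, 0 < z & f z = theta * z]].

(* The functions f whose Hirsch function is defined. *)
Definition admissible f : Prop :=
  nonneg_map f /\
  forall theta, 0 < theta -> exists! x, hirsch_solutions f theta x.

(* h_f; only meaningful for admissible f and theta > 0. *)
Definition hirsch f theta : R := xget 0 (hirsch_solutions f theta).

(* "h_f = phi on ]0, +oo[". *)
Definition hirsch_eq f phi : Prop :=
  admissible f /\ forall theta, 0 < theta -> hirsch f theta = phi theta.

Definition form_i phi : Prop := {in `[0, +oo[ &, injective phi}.

Definition form_ii phi y0 : Prop :=
  [/\ 0 < y0, {in `[0, y0], forall t, phi t = 0} &
      {in `]y0, +oo[ &, {homo phi : s t / s < t}}].

Definition form_iii phi x0 : Prop :=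
  [/\ 0 <= x0, {in `[x0, +oo[, forall t, phi t = 0} &
      {in `[0, x0[ &, {homo phi : s t /~ s < t}}].

Definition has_form phi : Prop :=
  [\/ form_i phi, exists y0, form_ii phi y0 | exists x0, form_iii phi x0].

(* g is the inverse function, from phi(D) to D, of the restriction of phi to
   the nonempty set D. *)
Definition inverse_on D phi g : Prop :=
  [/\ D !=set0, {in D, cancel phi g} & {in phi @` D, cancel g phi}].

(* The inverse of the restriction of phi to D (when the latter is injective),
   extended by 0 outside phi(D).  With f(x) = x * part_inv D phi x, this
   extension says f(x) = 0 for x > 0 outside phi(D); any other value f(x) >= 0
   would make x a solution of f(x) = theta x with theta = f(x) / x > 0. *)
Definition part_inv D phi x : R := xget 0 [set t | D t /\ phi t = x].

(* The functional equation f(phi(theta)) = theta phi(theta) on [0, +oo[. *)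
Definition functional_eq f phi : Prop :=
  forall theta, 0 <= theta -> f (phi theta) = theta * phi theta.

(* The functional equation only constrains f on phi([0, +oo[), whereas
   h_f = phi also forces f to vanish at the positive points outside it. *)
Definition null_off_range f phi : Prop :=
  forall x, 0 < x -> ~ (phi @` `[0, +oo[) x -> f x = 0.

End Hirsch.

(* Main.v *)
Require Import Defs.
From mathcomp Require Import all_boot all_order all_algebra.
From mathcomp Require Import all_classical all_reals all_analysis.
From mathcomp Require Import lra.
Import numFieldNormedType.Exports.
Import Order.TTheory GRing.Theory Num.Theory.
Local Open Scope classical_set_scope.
Local Open Scope ring_scope.

(* For theta, z > 0, the equality h_f = phi means that the graph of
   x |-> f(x) / x over ]0, +oo[ is, above height 0, the transpose of the graph
   of phi: f(z) = theta z iff phi(theta) = z; moreover f(0) = 0 when phi has a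
   zero in ]0, +oo[.  Hence phi is injective where it is positive.  By the
   intermediate value theorem a continuous nonnegative function with this
   property has neither an interior peak nor an interior dip, so it is monotone,
   and it can be constant on an interval only with the value 0: this leaves
   exactly the forms (i), (ii) and (iii). *)

(** * Hirsch functions, partial inverses and the functional equation *)

Section HirschSolutions.
Set Implicit Arguments.
Unset Strict Implicit.
Variable R : realType.
Implicit Types (f phi : R -> R) (D : set R) (x z t theta : R).

(** For each [theta] the value [phi theta] has to be the only member of [hirsch_solutions f theta].
    A positive solution always survives the convention, while 0 survives only if [f 0 = 0] and no
    positive solution exists; hence one clause for positive values and one for zeros of [phi]. *)
Lemma hirsch_eqP f phi : nonneg_map phi -> nonneg_map f ->
  hirsch_eq f phi <->
  (forall theta z, 0 < theta -> 0 < z -> f z = theta * z <-> phi theta = z) /\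
  (forall theta, 0 < theta -> phi theta = 0 -> f 0 = 0).
Proof.
move=> phi0 f0; split.
- move=> [[_ adm] heq].
  have sol theta : 0 < theta -> hirsch_solutions f theta (phi theta).
    move=> th0; have [x [solx _]] := adm _ th0.
    by rewrite -heq// /hirsch; apply: xgetPex; exists x.
  split=> [theta z th0 z0|theta th0 phith].
  + split=> [fz|<-]; last by have [] := sol _ th0.
    have [x [_ ux]] := adm _ th0.
    have solz : hirsch_solutions f theta z.
      by split; [exact: ltW|by []|move=> zE; rewrite zE ltxx in z0].
    by rewrite -(ux _ solz) -(ux _ (sol _ th0)).
  + by have [_] := sol _ th0; rewrite phith mulr0.
- move=> [pos zero].
  have sol theta : 0 < theta -> hirsch_solutions f theta (phi theta).
    move=> th0; split; first exact/phi0/ltW.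
      have := phi0 theta (ltW th0); rewrite le_eqVlt => /orP[/eqP phith|phith].
        by rewrite -phith mulr0 (zero theta).
      exact/pos.
    by move=> phith [z z0 /(pos _ _ th0 z0)]; rewrite phith => zE;
      rewrite -zE ltxx in z0.
  have uniq theta x : 0 < theta -> hirsch_solutions f theta x ->
      phi theta = x.
    move=> th0 [x0 fx solx]; move: x0; rewrite le_eqVlt => /orP[/eqP xE|x0].
      have := phi0 theta (ltW th0); rewrite le_eqVlt => /orP[/eqP <-//|phith].
      case: (solx (esym xE)); exists (phi theta) => //; exact/pos.
    exact/pos.
  split; first split=> // theta th0.
    by exists (phi theta); split; [exact: sol|move=> x; exact: uniq].
  move=> theta th0; rewrite /hirsch; case: xgetP => [x _ /(uniq _ _ th0)//|].
  by move=> /(_ _ (sol _ th0)).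
Qed.

(* D is the domain of the injective part of phi: [0, +oo[, ]y0, +oo[ or [0, x0[
   in the forms (i), (ii) and (iii). *)
Definition carries_support D phi :=
  [/\ forall t, D t -> 0 <= t,
      forall s t, D s -> D t -> phi s = phi t -> s = t
    & forall t, 0 <= t -> 0 < phi t -> D t].

Lemma part_invK D phi : carries_support D phi ->
  forall t, D t -> part_inv D phi (phi t) = t.
Proof.
move=> [_ inj _] t Dt; rewrite /part_inv.
by case: xgetP => [s _ [Ds /inj]|/(_ t)[]//]; exact.
Qed.

Lemma inverse_on_part_inv D phi : carries_support D phi -> D !=set0 ->
  inverse_on D phi (part_inv D phi).
Proof.
move=> cD D0; split=> // [t|x]; rewrite inE; first exact: part_invK.
by move=> [t Dt <-]; rewrite part_invK.
Qed.

Lemma part_inv_ge0 D phi : carries_support D phi ->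
  forall x, 0 <= part_inv D phi x.
Proof.
by move=> [D0 _ _] x; rewrite /part_inv; case: xgetP => // t _ [/D0].
Qed.

(** Positivity of [theta] excludes the default value 0 of [part_inv], and positivity of [z] puts
    every nonnegative preimage of [z] in [D]. *)
Lemma part_invP D phi : carries_support D phi ->
  forall theta z, 0 < theta -> 0 < z ->
  part_inv D phi z = theta <-> phi theta = z.
Proof.
move=> cD theta z th0 z0; split=> [|phith]; last first.
  have [_ _ supp] := cD.
  by rewrite -phith part_invK//; apply: supp; rewrite ?phith// ltW.
rewrite /part_inv; case: xgetP => [t _ [_ <-] -> //|_ thE].
by rewrite -thE ltxx in th0.
Qed.

(** For [x > 0], both [f x / x] and [part_inv D phi x] are nonnegative. The left-hand side says that
    they take the same positive values at the same points, so they also vanish together. *)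
Lemma part_inv_formulaP D phi f : nonneg_map f -> carries_support D phi ->
  (forall theta z, 0 < theta -> 0 < z -> f z = theta * z <-> phi theta = z) <->
  (forall x, 0 < x -> f x = x * part_inv D phi x).
Proof.
move=> f0 cD; split=> [pos x x0|fE theta z th0 z0].
- have fxE : f x = f x / x * x by rewrite divfK// gt_eqF.
  have [q0|q0] := ltP 0 (f x / x).
    by have /(part_invP cD q0 x0) -> := (pos _ _ q0 x0).1 fxE; rewrite mulrC.
  have fx0 : f x = 0.
    rewrite ler_pdivrMr// mul0r in q0.
    by apply/eqP; rewrite eq_le q0 f0// ltW.
  have := part_inv_ge0 cD x; rewrite le_eqVlt => /orP[/eqP <-|p0].
    by rewrite mulr0.
  have /(pos _ _ p0 x0) -> : phi (part_inv D phi x) = x by exact/(part_invP cD).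
  by rewrite mulrC.
- rewrite fE// mulrC -(part_invP cD th0 z0); split=> [|->//].
  by apply: mulIf; rewrite gt_eqF.
Qed.

(** If [f z = theta * z] is positive, [z] cannot lie off the range of [phi]; writing [z = phi t]
    gives [t * z = theta * z], and [z] cancels. *)
Lemma functional_eq_hirsch_eq f phi : nonneg_map phi -> nonneg_map f ->
  functional_eq f phi -> null_off_range f phi -> hirsch_eq f phi.
Proof.
move=> phi0 f0 feq fnull; apply/hirsch_eqP => //; split; last first.
  by move=> theta th0 phith; rewrite -phith feq ?ltW// phith mulr0.
move=> theta z th0 z0; split=> [fz|<-]; last by rewrite feq// ltW.
have [[t t0 tz]|zoff] := pselect ((phi @` `[0, +oo[) z).
  rewrite -tz; congr phi; apply: (@mulIf _ z); first by rewrite gt_eqF.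
  move: t0; rewrite /= in_itv/= andbT => t0.
  by rewrite -fz -tz feq.
by have := mulr_gt0 th0 z0; rewrite -fz fnull// ltxx.
Qed.

(** The functional equation includes [theta = 0], about which [hirsch_eq] is silent. When
    [phi 0 = 0] it reads [f 0 = 0] there, which explains the extra hypothesis. *)
Lemma hirsch_eq_functional_eq D f phi : nonneg_map phi -> nonneg_map f ->
  carries_support D phi -> (phi 0 = 0 -> f 0 = 0) ->
  hirsch_eq f phi -> functional_eq f phi /\ null_off_range f phi.
Proof.
move=> phi0 f0 cD f00 /(hirsch_eqP phi0 f0)[pos zero].
have fE := (part_inv_formulaP f0 cD).1 pos.
split=> [theta th0|x x0 xoff].
- have := phi0 _ th0; rewrite le_eqVlt => /orP[/eqP phith|phith].
    rewrite -phith mulr0; move: th0; rewrite le_eqVlt => /orP[/eqP thE|th0].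
      by apply: f00; rewrite {1}thE -phith.
    exact: (zero theta).
  have [_ _ supp] := cD.
  by rewrite fE// part_invK// 1?mulrC//; exact: supp.
- rewrite fE// /part_inv; case: xgetP => [t _ [Dt tx]|_]; last by rewrite mulr0.
  have [D0 _ _] := cD.
  by case: xoff; exists t => //=; rewrite in_itv/= D0.
Qed.

(** A positive zero of [phi] triggers the second clause of [hirsch_eqP], which then amounts to
    [f 0 = 0]. *)
Lemma hirsch_eq_part_inv D f phi : nonneg_map phi -> nonneg_map f ->
  carries_support D phi -> (exists2 t, 0 < t & phi t = 0) ->
  hirsch_eq f phi <->
  f 0 = 0 /\ forall x, 0 < x -> f x = x * part_inv D phi x.
Proof.
move=> phi0 f0 cD [t t0 phit]; rewrite hirsch_eqP//.
rewrite (part_inv_formulaP f0 cD); split=> [[fE /(_ _ t0 phit)]//|[f00 fE]].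
by split.
Qed.

Lemma ex_hirsch_eq D phi : nonneg_map phi -> carries_support D phi ->
  exists f : R -> R, hirsch_eq f phi.
Proof.
move=> phi0 cD; exists (fun x => x * part_inv D phi x).
have f0 : nonneg_map (fun x => x * part_inv D phi x).
  by move=> x x0; rewrite mulr_ge0// part_inv_ge0.
apply/hirsch_eqP => //; split; first exact/(part_inv_formulaP f0 cD).
by move=> *; rewrite mul0r.
Qed.

(** * The injective part in each of the three forms *)

Lemma form_i_support phi : form_i phi -> carries_support `[0, +oo[ phi.
Proof.
move=> inj; split=> [t|s t Ds Dt|t t0 _]; rewrite /= ?in_itv/= ?andbT//.
exact: inj.
Qed.

Lemma form_ii_support phi y0 : form_ii phi y0 ->
  carries_support `]y0, +oo[ phi.
Proof.
move=> [y00 phi0 phiI]; split=> [t|s t Ds Dt|t t0 phit].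
- by rewrite /= in_itv/= andbT => /(lt_trans y00)/ltW.
- case: (ltgtP s t) => // st phiE.
    by have := phiI _ _ Ds Dt st; rewrite phiE ltxx.
  by have := phiI _ _ Dt Ds st; rewrite phiE ltxx.
- rewrite /= in_itv/= andbT ltNge; apply/negP => ty0.
  by move: phit; rewrite phi0 ?ltxx// in_itv/= t0.
Qed.

Lemma form_iii_support phi x0 : form_iii phi x0 ->
  carries_support `[0, x0[ phi.
Proof.
move=> [x00 phi0 phiI]; split=> [t|s t Ds Dt|t t0 phit].
- by rewrite /= in_itv/= => /andP[].
- case: (ltgtP s t) => // st phiE.
    by have := phiI _ _ Dt Ds st; rewrite phiE ltxx.
  by have := phiI _ _ Ds Dt st; rewrite phiE ltxx.
- rewrite /= in_itv/= t0 ltNge; apply/negP => tx0.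
  by move: phit; rewrite phi0 ?ltxx// in_itv/= tx0.
Qed.

End HirschSolutions.

(** * Continuous functions that are injective where positive *)

Section Forms.
Variables (R : realType) (phi : R -> R).
Hypothesis phi_ge0 : nonneg_map phi.
Hypothesis phi_cont : {within `[0, +oo[, continuous phi}.
Set Implicit Arguments.
Unset Strict Implicit.
Implicit Types a b c s t v : R.

(** The strict bounds on [v] keep [c] off both endpoints, so points found on adjacent intervals are
    distinct. *)
Lemma ivt_within a b v : 0 <= a -> a < b ->
  Num.min (phi a) (phi b) < v < Num.max (phi a) (phi b) ->
  exists2 c, a < c < b & phi c = v.
Proof.
move=> a0 ab vab.
have cab : {within `[a, b], continuous phi}.
  apply: continuous_subspaceW phi_cont => x; rewrite /= !in_itv/= andbT.
  by move=> /andP[/(le_trans a0)].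
have /andP[v1 v2] := vab.
have [|c] := IVT (ltW ab) cab (v := v); first by rewrite !ltW.
rewrite in_itv/= => /andP[ac cb] phic; exists c => //.
rewrite !lt_neqAle ac cb !andbT; apply/andP; split; apply/eqP => cE;
  move: vab; rewrite -phic -?cE ?cE gt_min lt_max !ltxx /= ?orbF;
  by move=> /andP[/lt_trans H /H]; rewrite ltxx.
Qed.

Section InjectiveOnSupport.
Hypothesis phi_inj : forall s t, 0 < s -> 0 < t -> 0 < phi s ->
  phi s = phi t -> s = t.

(** A level [v] just below a peak would be attained on both sides of [b], at positive points; [v] is
    positive because it exceeds [phi a]. *)
Lemma no_interior_peak a b c : 0 <= a -> a < b -> b < c ->
  phi b <= Num.max (phi a) (phi c).
Proof.
move=> a0 ab bc; rewrite leNgt; apply/negP => H.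
have [v /andP[v1 v2]] : exists v, Num.max (phi a) (phi c) < v < phi b.
  by exists ((Num.max (phi a) (phi c) + phi b) / 2); rewrite !midf_lt.
move: v1; rewrite gt_max => /andP[va vc].
have v0 : 0 < v by exact: le_lt_trans (phi_ge0 a0) va.
have [|s /andP[s1 s2] sv] := @ivt_within a b v a0 ab.
  by rewrite gt_min va lt_max v2 orbT.
have [|t /andP[t1 t2] tv] := @ivt_within b c v (ltW (le_lt_trans a0 ab)) bc.
  by rewrite gt_min vc orbT lt_max v2.
have s0 := le_lt_trans a0 s1.
have st : s = t.
  by apply: phi_inj; rewrite ?sv ?tv//; apply: lt_trans s0 (lt_trans s2 t1).
by move: (lt_trans s2 t1); rewrite st ltxx.
Qed.

(** The same argument with a level above the dip, which is positive even if [phi b = 0]. *)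
Lemma no_interior_dip a b c : 0 <= a -> a < b -> b < c ->
  Num.min (phi a) (phi c) <= phi b.
Proof.
move=> a0 ab bc; rewrite leNgt; apply/negP => H.
have b0 := le_lt_trans a0 ab.
have [v /andP[v1 v2]] : exists v, phi b < v < Num.min (phi a) (phi c).
  by exists ((phi b + Num.min (phi a) (phi c)) / 2); rewrite !midf_lt.
move: v2; rewrite lt_min => /andP[va vc].
have v0 : 0 < v by exact: le_lt_trans (phi_ge0 (ltW b0)) v1.
have [|s /andP[s1 s2] sv] := @ivt_within a b v a0 ab.
  by rewrite gt_min v1 orbT lt_max va.
have [|t /andP[t1 t2] tv] := @ivt_within b c v (ltW b0) bc.
  by rewrite gt_min v1 lt_max vc orbT.
have s0 := le_lt_trans a0 s1.
have st : s = t.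
  by apply: phi_inj; rewrite ?sv ?tv//; apply: lt_trans s0 (lt_trans s2 t1).
by move: (lt_trans s2 t1); rewrite st ltxx.
Qed.

(** Taking 0 as left point, the absence of peaks and dips puts [phi b] between [phi 0] and [phi c]
    whenever [0 < b < c]. Whether some value exceeds [phi 0] then decides the direction for all
    pairs. *)
Lemma monotone_on_nonneg :
  (forall s t, 0 <= s -> s <= t -> phi s <= phi t) \/
  (forall s t, 0 <= s -> s <= t -> phi t <= phi s).
Proof.
have betw b c : 0 < b -> b < c ->
    (phi 0 <= phi b <= phi c) || (phi c <= phi b <= phi 0).
  move=> b0 bc; have := no_interior_peak (lexx 0) b0 bc.
  have := no_interior_dip (lexx 0) b0 bc; rewrite ge_min le_max.
  by do 4! case: leP => //; move=> *; lra.
have [[b b0 phib]|Nb] := pselect (exists2 b, 0 < b & phi 0 < phi b).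
- have above c : 0 <= c -> phi 0 <= phi c.
    rewrite le_eqVlt => /orP[/eqP <-//|c0].
    case: (ltgtP b c) => [bc|cb|<-]; last exact: ltW.
      by have := betw _ _ b0 bc => /orP[] /andP[]; lra.
    by have := betw _ _ c0 cb => /orP[] /andP[]; lra.
  left=> s t; rewrite le_eqVlt => /orP[/eqP <-|s0]; first exact: above.
  rewrite le_eqVlt => /orP[/eqP -> //|st].
  have := above t (ltW (lt_trans s0 st)).
  by have := betw _ _ s0 st => /orP[] /andP[]; lra.
- have below c : 0 <= c -> phi c <= phi 0.
    rewrite le_eqVlt => /orP[/eqP <-//|c0].
    by rewrite leNgt; apply/negP => ?; apply: Nb; exists c.
  right=> s t; rewrite le_eqVlt => /orP[/eqP <-|s0]; first exact: below.
  rewrite le_eqVlt => /orP[/eqP -> //|st].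
  have := below t (ltW (lt_trans s0 st)).
  by have := betw _ _ s0 st => /orP[] /andP[]; lra.
Qed.

(** Injectivity is applied to [t] and the midpoint, which is positive even when [s = 0]. *)
Lemma eq_between_eq0 s t : 0 <= s -> s < t ->
  (forall u, s < u < t -> phi u = phi t) -> phi t = 0.
Proof.
move=> s0 st cst; have t0 := le_lt_trans s0 st.
have m : s < (s + t) / 2 < t by rewrite !midf_lt.
have /andP[sm mt] := m.
have := phi_ge0 (ltW t0); rewrite le_eqVlt => /orP[/eqP //|phit].
have mE : (s + t) / 2 = t.
  by apply: phi_inj; rewrite ?cst// (le_lt_trans s0).
by rewrite mE ltxx in mt.
Qed.

(** The zero function has form (iii), a function without positive zeros has form (i), and otherwise
    form (ii) holds with [y0] the supremum of the zeros. *)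
Lemma has_form_nondecreasing :
  (forall s t, 0 <= s -> s <= t -> phi s <= phi t) -> has_form phi.
Proof.
move=> mono.
(* Equality would make [phi] constant on [[s, t]], hence zero at [t]; this also reaches [s = 0],
   which [phi_inj] does not cover. *)
have strict s t : 0 <= s -> s < t -> 0 < phi t -> phi s < phi t.
  move=> s0 st phit; rewrite lt_neqAle mono ?(ltW st)// andbT.
  apply/eqP => phist; move: phit; rewrite (@eq_between_eq0 s t) ?ltxx//.
  move=> u /andP[su ut]; apply/eqP; rewrite eq_le -{2}phist.
  by rewrite !mono// ltW// (le_lt_trans s0).
have [phiz|/existsNP[p /not_implyP[p0 /eqP phip]]] :=
    pselect (forall t, 0 <= t -> phi t = 0).
  apply: Or33; exists 0; split=> //.
    by move=> t; rewrite in_itv/= andbT; exact: phiz.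
  by move=> s t; rewrite !in_itv/= => /andP[/le_lt_trans H /H]; rewrite ltxx.
have phip0 : 0 < phi p by rewrite lt_neqAle eq_sym phip phi_ge0.
pose Z := [set t | 0 <= t /\ phi t = 0].
(* A zero at 0 alone is compatible with injectivity, so the case split is on positive zeros. *)
have [[z [z0 phiz] zgt0]|NZ] := pselect (exists2 z, Z z & 0 < z); last first.
  apply: Or31 => s t; rewrite !in_itv/= !andbT => s0 t0 phist.
  have pos u : 0 < u -> 0 < phi u.
    move=> u0; rewrite lt_neqAle phi_ge0 ?ltW// andbT eq_sym.
    by apply/eqP => phiu; apply: NZ; exists u => //; split=> //; exact: ltW.
  case: (ltgtP s t) => // st.
    by have := strict _ _ s0 st (pos _ (le_lt_trans s0 st)); rewrite phist ltxx.
  by have := strict _ _ t0 st (pos _ (le_lt_trans t0 st)); rewrite phist ltxx.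
have supZ : has_sup Z.
  split; first by exists z.
  exists p => t [t0 phit]; rewrite leNgt; apply/negP => pt.
  by have := mono _ _ p0 (ltW pt); rewrite phit leNgt phip0.
have y0gt0 : 0 < sup Z.
  by apply: lt_le_trans zgt0 _; apply: ub_le_sup; [case: supZ|].
(* Otherwise half of [phi (sup Z)] is attained at some [c < sup Z], although a zero lies beyond
   [c]. *)
have phiy0 : phi (sup Z) = 0.
  have := phi_ge0 (ltW y0gt0); rewrite le_eqVlt => /orP[/eqP //|phiy].
  have phi00 : phi 0 = 0.
    by apply/eqP; rewrite eq_le phi_ge0// andbT -{2}phiz mono.
  have [|c /andP[c0 cy] phic] := @ivt_within 0 (sup Z) (phi (sup Z) / 2)
      (lexx _) y0gt0.
    by rewrite phi00 gt_min lt_max; apply/andP; split; apply/orP; lra.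
  have [t [t0 phit]] := sup_adherent (eps := sup Z - c) (ltac:(lra)) supZ.
  rewrite subKr => ct.
  by have := mono _ _ (ltW c0) (ltW ct); rewrite phit phic; lra.
apply: Or32; exists (sup Z); split=> //.
  move=> t; rewrite in_itv/= => /andP[t0 ty].
  by apply/eqP; rewrite eq_le phi_ge0// andbT -phiy0 mono.
move=> s t; rewrite !in_itv/= !andbT => sy ty st.
have t0 := lt_trans y0gt0 ty.
apply: strict => //; first exact/ltW/(lt_trans y0gt0).
rewrite lt_neqAle phi_ge0 ?ltW// andbT eq_sym; apply/eqP => phit.
move: ty; rewrite ltNge => /negP; apply; apply: ub_le_sup; first by case: supZ.
by split=> //; exact: ltW.
Qed.

(** Without zeros [phi] is injective; otherwise [x0] is the infimum of the zeros. A zero at 0 gives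
    [x0 = 0] and the zero function. *)
Lemma has_form_nonincreasing :
  (forall s t, 0 <= s -> s <= t -> phi t <= phi s) -> has_form phi.
Proof.
move=> mono.
have strict s t : 0 <= s -> s < t -> 0 < phi s -> phi t < phi s.
  move=> s0 st phis; rewrite lt_neqAle mono ?(ltW st)// andbT.
  apply/eqP => phist; move: phis; rewrite -phist (@eq_between_eq0 s t) ?ltxx//.
  move=> u /andP[su ut]; apply/eqP; rewrite eq_le {1}phist.
  by rewrite !mono// ltW// (le_lt_trans s0).
pose Z := [set t | 0 <= t /\ phi t = 0].
have [[z [z0 phiz]]|NZ] := pselect (exists z, Z z); last first.
  apply: Or31 => s t; rewrite !in_itv/= !andbT => s0 t0 phist.
  have pos u : 0 <= u -> 0 < phi u.
    move=> u0; rewrite lt_neqAle phi_ge0// andbT eq_sym.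
    by apply/eqP => phiu; apply: NZ; exists u.
  case: (ltgtP s t) => // st.
    by have := strict _ _ s0 st (pos _ s0); rewrite phist ltxx.
  by have := strict _ _ t0 st (pos _ t0); rewrite phist ltxx.
have infZ : has_inf Z by split; [exists z|exists 0 => t []].
have lbZ t : Z t -> inf Z <= t by move=> Zt; apply: ge_inf => //; case: infZ.
have x0ge0 : 0 <= inf Z by apply: lb_le_inf; [case: infZ|move=> t []].
(* Otherwise half of [phi (inf Z)] is attained at some [c > inf Z], although a zero lies before
   [c]. *)
have phix0 : phi (inf Z) = 0.
  have := phi_ge0 x0ge0; rewrite le_eqVlt => /orP[/eqP //|phix].
  have xz : inf Z < z.
    rewrite lt_neqAle lbZ// andbT; apply/eqP => xz.
    by move: phix; rewrite xz phiz ltxx.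
  have [|c /andP[xc cz] phic] := @ivt_within (inf Z) z (phi (inf Z) / 2)
      x0ge0 xz.
    by rewrite phiz gt_min lt_max; apply/andP; split; apply/orP; lra.
  have [t [t0 phit]] := inf_adherent (eps := c - inf Z) (ltac:(lra)) infZ.
  rewrite addrC subrK => tc.
  by have := mono _ _ t0 (ltW tc); rewrite phit phic; lra.
apply: Or33; exists (inf Z); split=> //.
  move=> t; rewrite in_itv/= andbT => xt.
  by apply/eqP; rewrite eq_le phi_ge0 ?(le_trans x0ge0)// andbT -phix0 mono.
move=> t s; rewrite !in_itv/= => /andP[t0 tx] /andP[s0 sx] st.
apply: strict => //; rewrite lt_neqAle phi_ge0// andbT eq_sym.
by apply/eqP => phis; move: sx; rewrite ltNge lbZ.
Qed.

Lemma has_form_inj_support : has_form phi.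
Proof.
by case: monotone_on_nonneg; [exact: has_form_nondecreasing|
                              exact: has_form_nonincreasing].
Qed.

End InjectiveOnSupport.

(** If [phi s] and [phi t] are the same positive [x], then [s * x = f x = t * x], so [s = t]. *)
Lemma hirsch_eq_has_form f : hirsch_eq f phi -> has_form phi.
Proof.
move=> hf; have [[f0 _] _] := hf.
have [pos _] := (hirsch_eqP phi_ge0 f0).1 hf.
apply: has_form_inj_support => s t s0 t0 phis phist.
have fs := (pos _ _ s0 phis).2 erefl.
have ft := (pos _ _ t0 phis).2 (esym phist).
by apply: (@mulIf _ (phi s)); rewrite -?fs -?ft// gt_eqF.
Qed.

(** A zero at [t > 0] would be a dip between 0 and [t + t], where injectivity makes [phi] positive.
    In form (i) the clause of [hirsch_eqP] on [f 0] is therefore vacuous. *)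
Lemma form_i_gt0 t : form_i phi -> 0 < t -> 0 < phi t.
Proof.
move=> inj t0; rewrite lt_neqAle phi_ge0 ?ltW// andbT eq_sym.
have injp u v : 0 <= u -> 0 <= v -> phi u = phi v -> u = v.
  by move=> u0 v0; apply: inj; rewrite in_itv/= andbT.
apply/eqP => phit.
have pos u : 0 <= u -> u != t -> 0 < phi u.
  move=> u0 ut; rewrite lt_neqAle phi_ge0// andbT eq_sym.
  apply: contra_neq ut => phiu; apply: injp; rewrite ?phit//; exact: ltW.
have t2 : t < t + t by lra.
have p1 : 0 < phi 0 by apply: pos; rewrite ?lt_eqF.
have p2 : 0 < phi (t + t) by apply: pos; rewrite ?gt_eqF//; lra.
have := @no_interior_dip _ 0 t (t + t) (lexx 0) t0 t2.
rewrite phit leNgt lt_min p1 p2 => /(_ _)/negP; apply=> //.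
by move=> u v u0 v0 _; apply: injp; exact: ltW.
Qed.

End Forms.

(** * Assembly of the three forms *)

Theorem theorem5 (R : realType) (phi : R -> R)
    (phi_ge0 : nonneg_map phi)
    (phi_cont : {within `[0, +oo[, continuous phi}) :
  [/\ (* no solution when phi is of none of the three forms *)
      ~ has_form phi -> ~ exists f : R -> R, hirsch_eq f phi,

      (* the functional equation *)
      has_form phi ->
        forall f : R -> R, nonneg_map f ->
          (form_i phi -> phi 0 = 0 -> f 0 = 0) ->
          (hirsch_eq f phi <-> functional_eq f phi /\ null_off_range f phi),

      form_i phi ->
        [/\ inverse_on `[0, +oo[ phi (part_inv `[0, +oo[ phi),
            exists f : R -> R, hirsch_eq f phi
          & forall f : R -> R, nonneg_map f ->
              (hirsch_eq f phi <->
               forall x, 0 < x -> f x = x * part_inv `[0, +oo[ phi x)],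

      forall y0 : R, form_ii phi y0 ->
        [/\ inverse_on `]y0, +oo[ phi (part_inv `]y0, +oo[ phi),
            exists f : R -> R, hirsch_eq f phi
          & forall f : R -> R, nonneg_map f ->
              (hirsch_eq f phi <->
               f 0 = 0 /\
               forall x, 0 < x -> f x = x * part_inv `]y0, +oo[ phi x)]
    & forall x0 : R, form_iii phi x0 ->
        (0 < x0 ->
          [/\ inverse_on `[0, x0[ phi (part_inv `[0, x0[ phi),
              exists f : R -> R, hirsch_eq f phi
            & forall f : R -> R, nonneg_map f ->
                (hirsch_eq f phi <->
                 f 0 = 0 /\
                 forall x, 0 < x -> f x = x * part_inv `[0, x0[ phi x)]) /\
        (x0 = 0 ->
          [/\ ~ (exists g : R -> R, inverse_on `[0, x0[ phi g),
              forall theta, 0 <= theta -> phi theta = 0,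
              hirsch_eq (fun=> 0) phi
            & forall f : R -> R, hirsch_eq f phi ->
                forall x, 0 <= x -> f x = 0])].
Proof.
have zero_ii y0 : form_ii phi y0 -> exists2 t, 0 < t & phi t = 0.
  move=> [y00 phiz _]; exists y0 => //.
  by apply: phiz; rewrite in_itv/= lexx ltW.
have zero_iii x0 : form_iii phi x0 -> exists2 t, 0 < t & phi t = 0.
  (* The shift by 1 keeps the zero positive when [x0 = 0]. *)
  move=> [x00 phiz _]; exists (x0 + 1); first by rewrite ltr_wpDl.
  by apply: phiz; rewrite in_itv/= lerDl ler01.
split.
- by move=> nform [f /(hirsch_eq_has_form phi_ge0 phi_cont)].
- move=> form f f0 f00; split; last first.
    by move=> [feq fnull]; exact: functional_eq_hirsch_eq.
  (* The value [f 0 = 0] is assumed in form (i) when [phi 0 = 0]; in the other forms it follows from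
     a positive zero of [phi]. *)
  have [fi|[y0 fii]|[x0 fiii]] := form => hf.
  + apply: (hirsch_eq_functional_eq (D := `[0, +oo[)) => //.
      exact: form_i_support.
    exact: f00.
  + apply: (hirsch_eq_functional_eq (D := `]y0, +oo[)) => //.
      exact: form_ii_support.
    have [t t0 phit] := zero_ii _ fii.
    by move=> _; exact: ((hirsch_eqP phi_ge0 f0).1 hf).2 t t0 phit.
  + apply: (hirsch_eq_functional_eq (D := `[0, x0[)) => //.
      exact: form_iii_support.
    have [t t0 phit] := zero_iii _ fiii.
    by move=> _; exact: ((hirsch_eqP phi_ge0 f0).1 hf).2 t t0 phit.
- move=> fi; have cD := form_i_support fi; split.
  + by apply: inverse_on_part_inv => //; exists 0; rewrite /= in_itv/= lexx.
  + exact: ex_hirsch_eq cD.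
  + move=> f f0; rewrite hirsch_eqP// (part_inv_formulaP f0 cD).
    split=> [[]//|fE]; split=> // t t0 phit.
    by have := form_i_gt0 phi_ge0 phi_cont fi t0; rewrite phit ltxx.
- move=> y0 fii; have cD := form_ii_support fii; split.
  + apply: inverse_on_part_inv => //; exists (y0 + 1).
    by rewrite /= in_itv/= ltrDl ltr01.
  + exact: ex_hirsch_eq cD.
  + by move=> f f0; apply: hirsch_eq_part_inv => //; exact: zero_ii fii.
- move=> x0 fiii; have cD := form_iii_support fiii; split.
  + move=> x0gt0; split.
    * apply: inverse_on_part_inv => //; exists 0.
      by rewrite /= in_itv/= lexx.
    * exact: ex_hirsch_eq cD.
    * by move=> f f0; apply: hirsch_eq_part_inv => //; exact: zero_iii fiii.
  + move=> x0E; have phiz t : 0 <= t -> phi t = 0.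
      by move=> t0; have [_ + _] := fiii; apply; rewrite x0E in_itv/= t0.
    split=> //.
    (* [[0, 0[] is empty, whereas [inverse_on] requires a nonempty domain. *)
    * move=> [g [[t]]]; rewrite x0E /= in_itv/= => /andP[t0 /(le_lt_trans t0)].
      by rewrite ltxx.
    * apply/hirsch_eqP => //; split=> // theta z th0 z0.
      rewrite phiz ?ltW//; split=> /eqP; last by rewrite lt_eqF.
      by rewrite lt_eqF// mulr_gt0.
    * move=> f hf; have [[f0 _] _] := hf.
      have [f00 fE] :=
        (hirsch_eq_part_inv phi_ge0 f0 cD (zero_iii _ fiii)).1 hf.
      move=> x; rewrite le_eqVlt => /orP[/eqP <-//|xgt0].
      (* A preimage of [x] would force [x = 0] since [phi] vanishes; without one, [part_inv] takes
         its default value 0. *)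
      rewrite fE// /part_inv; case: xgetP => [t _ [Dt]|_]; last by rewrite mulr0.
      have [D0 _ _] := cD.
      by rewrite phiz ?D0// => xE; rewrite -xE mul0r.
Qed.
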